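(* Let $(V,\Omega)$ be a symplectic vector space with canonical Liouville form $\theta$, given by $\theta_z(v_z)=\frac12\Omega(z,v)$ for $z,v\in V$. For $a\in V$ let $\psi^a(z)=\frac12\Omega(a,z)$, let $\theta^a=\theta+{\rm d}\psi^a$, and let $\tau_a:V\to V$, $\tau_a(z)=z+a$. Then for all $a,b\in V$, $${\rm Iso}(V^a,V^b)=\{\tau_b^{-1}\circ\gamma\circ\tau_a:\gamma\in{\rm Sp}(V,\Omega)\},$$ where ${\rm Iso}(V^a,V^b)$ is the set of all smooth maps $g:V\to V$ such that $g^*\theta^b=\theta^a$.
   Context: A symplectic vector space $(V,\Omega)$ is a finite-dimensional real vector space $V$ with a nonsingular alternating bilinear form $\Omega$. Regard $V$ as a smooth manifold; for $z,v\in V$ let $v_z\in T_zV$ be the tangent vector given by $v_z\psi=\frac{\rm d}{{\rm d}t}\psi(z+tv)|_{t=0}$ for smooth $\psi:V\to\mathbb{R}$. ${\rm Sp}(V,\Omega)$ is the group of linear automorphisms $g$ of $V$ with $\Omega(gx,gy)=\Omega(x,y)$ for all $x,y\in V$. *)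

(* Defs.v *)
From HB Require Import structures.
From mathcomp Require Import all_boot all_order all_algebra.
From mathcomp Require Import sesquilinear.
From mathcomp Require Import boolp classical_sets functions reals topology.
From mathcomp Require Import normedtype landau derive.

Set Implicit Arguments.
Unset Strict Implicit.
Unset Printing Implicit Defensive.

Import Order.TTheory GRing.Theory Num.Theory.
Import numFieldNormedType.Exports VectorInternalTheory.

Local Open Scope classical_set_scope.
Local Open Scope ring_scope.

(* A finite-dimensional real vector space V carries no canonical norm, but all
   its norms induce the same topology and the same differential calculus.
   [normed_of V] is V with the sup norm of the coordinates [v2r]; it serves to
   make the library's continuity and Fréchet differentials available on V. *)
Definition normed_of (R : realType) (V : vectType R) : Type := V.

HB.instance Definition _ (R : realType) (V : vectType R) :=
  GRing.Lmodule.on (normed_of V).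

Section NormedOf.
Variables (R : realType) (V : vectType R).
Implicit Types x y : normed_of V.

Let norm x : R := `|v2r (x : V)|.

Let normD x y : norm (x + y) <= norm x + norm y.
Proof. by rewrite /norm linearD ler_normD. Qed.

Let normZ (k : R) x : norm (k *: x) = `|k| * norm x.
Proof. by rewrite /norm linearZ normrZ. Qed.

Let norm_eq0 x : norm x = 0 -> x = 0.
Proof. by move/normr0_eq0 => x0; apply: v2r_inj; rewrite x0 linear0. Qed.

HB.instance Definition _ :=
  Lmodule_isNormed.Build R (normed_of V) normD normZ norm_eq0.
End NormedOf.

(* Differentiating x |-> 'd f x direction by direction is the same as
   differentiating it as a map into the linear maps when the domain is
   finite-dimensional, which is the only case used below. *)
Fixpoint Ck (R : realType) (U W : normedModType R) (k : nat) (f : U -> W) :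
    Prop :=
  if k is k'.+1 then
    (forall x, differentiable f x) /\ (forall v, Ck k' (fun x => 'd f x v))
  else continuous f.

Section Calculus.
Variables (R : realType) (V : vectType R).

Definition smooth (g : V -> V) : Prop :=
  forall k, Ck k (g : normed_of V -> normed_of V).

(* The differential dg_z : V -> V, where T_z V and T_(g z) V are identified
   with V through v |-> v_z. *)
Definition differential (g : V -> V) (z v : V) : V :=
  'd (g : normed_of V -> normed_of V) (z : normed_of V) v.

(* The tangent vector v_z, as a derivation. *)
Definition tangent (z v : V) (psi : V -> R) : R :=
  derive1 (fun t : R => psi (z + t *: v)) 0.

(* The differential is the pushforward of tangent vectors:
   g_* v_z = (dg_z v)_(g z). *)
Lemma tangent_differential (g : V -> V) (psi : V -> R) (z v : V) :
  differentiable (g : normed_of V -> normed_of V) (z : normed_of V) ->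
  differentiable (psi : normed_of V -> R) (g z : normed_of V) ->
  tangent (g z) (differential g z v) psi = tangent z v (psi \o g).
Proof.
have tangentE (f : normed_of V -> R) (x w : normed_of V) :
    differentiable f x -> tangent x w f = 'd f x w.
  have E : (fun h : R => h^-1 *: (f (x + (h + 0) *: w) - f (x + 0 *: w))) =
      (fun h : R => h^-1 *: ((f \o shift x) (h *: w) - f x)).
    by apply/funext => h /=; rewrite addr0 scale0r addr0 [x + _]addrC.
  by move=> df; rewrite -deriveE//; exact: (congr1 (fun F => lim (F @ 0^')) E).
move=> dg dpsi; rewrite (tangentE psi)// (tangentE (psi \o g)).
  by rewrite (@diff_comp _ _ _ _ (g : normed_of V -> normed_of V)).
exact: (@differentiable_comp _ _ _ _ (g : normed_of V -> normed_of V)).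
Qed.

(* A 1-form alpha on V is given by its values alpha z v = alpha_z(v_z). *)
Definition dform (psi : V -> R) (z v : V) : R := tangent z v psi.

Definition pullback (g : V -> V) (alpha : V -> V -> R) (z v : V) : R :=
  alpha (g z) (differential g z v).

Definition Iso (alpha beta : V -> V -> R) : set (V -> V) :=
  [set g | smooth g /\ pullback g beta = alpha].

Definition tau (a z : V) : V := z + a.

Definition tau_inv (a z : V) : V := z - a.

Lemma tauK a : cancel (tau a) (tau_inv a).
Proof. exact: addrK. Qed.

Lemma tau_invK a : cancel (tau_inv a) (tau a).
Proof. exact: subrK. Qed.

Variable Omega : {biscalar V}.

Definition alternating : Prop := forall x, Omega x x = 0.

Definition nonsingular : Prop := forall x, (forall y, Omega x y = 0) -> x = 0.

Definition symplectic : Prop := alternating /\ nonsingular.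

Definition Sp : set (V -> V) :=
  [set gamma | [/\ linear gamma, bijective gamma &
                  forall x y, Omega (gamma x) (gamma y) = Omega x y]].

Definition liouville (z v : V) : R := 2^-1 * Omega z v.

Definition psi_ (a z : V) : R := 2^-1 * Omega a z.

Definition theta_ (a z v : V) : R := liouville z v + dform (psi_ a) z v.

End Calculus.

(* Main.v *)
Require Import Defs.
From HB Require Import structures.
From mathcomp Require Import all_boot all_order all_algebra.
From mathcomp Require Import sesquilinear.
From mathcomp Require Import boolp classical_sets functions reals topology.
From mathcomp Require Import normedtype landau derive.
From mathcomp Require Import ring lra.

Set Implicit Arguments.
Unset Strict Implicit.
Unset Printing Implicit Defensive.

Import Order.TTheory GRing.Theory Num.Theory.
Import numFieldNormedType.Exports VectorInternalTheory.

Local Open Scope classical_set_scope.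
Local Open Scope ring_scope.

(** Evaluating d psi^a gives theta^a_z(v_z) = Omega(z + a, v) / 2, so that
    g is in Iso(V^a, V^b) when it is smooth and
      Omega(g z + b, dg_z v) = Omega(z + a, v) for all z, v.      (E)
    An affine map g z = gamma(z + a) - b with gamma in Sp satisfies (E), since
    its differential is gamma everywhere.

    For the converse, the idea is that g preserves the symplectic form
    d theta^a = d theta^b, hence carries the vector field dual to theta^a to
    the one dual to theta^b. These are the Euler fields centred at -a and -b, so
    g is homogeneous of degree one about these centres, and a homogeneous map
    that is differentiable at its centre is linear.
    - Differentiating (E) in the direction u and antisymmetrizing in u and v
      removes the second derivative of g, by its symmetry ([schwarz]), and
      leaves Omega(dg_z u, dg_z v) = Omega(u, v)
      ([differential_preserves_form]).
    - Then (E) reads Omega(g z + b, dg_z v) = Omega(dg_z (z + a), dg_z v); as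
      dg_z is onto and Omega is nonsingular, g z + b = dg_z (z + a) ([euler]).
    - On the ray z = -a + t w this is an equation p(t) = t p'(t), which forces
      p'' = 0 for t > 0, hence p(1) = p'(1) = p'(0), that is
      g (w - a) + b = dg_(-a) w ([Iso_radial]). So gamma = dg_(-a) is the
      required element of Sp.

    Identities between vectors are reduced to real-valued calculus on lines by
    pairing them with a fixed vector under Omega. *)

(** * Differential calculus on lines and in finite dimension *)

Section FiniteDimension.
Variables (R : realType) (V : vectType R).
Local Notation N := (normed_of V).

Let v2r_norm (x : N) : `|v2r (x : V)| = `|x|.
Proof. by []. Qed.

(** A linear map is bounded by the sum of the norms of its values on the basis,
    because the norm of [normed_of V] dominates every coordinate. *)
Lemma normed_of_linear_continuous (W : normedModType R) (f : {linear N -> W}) :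
  continuous f.
Proof.
pose e i : N := r2v (delta_mx 0 i).
have xE (x : N) : x = \sum_i v2r (x : V) 0 i *: e i.
  rewrite -[LHS](v2rK (x : V)) [v2r (x : V) in LHS]row_sum_delta linear_sum.
  by apply: eq_bigr => i _; rewrite linearZ.
apply: bounded_linear_continuous; apply/ex_bound.
exists (\sum_i `|f (e i)|).
apply/nbhs_normP; exists 1 => //= x /=.
rewrite sub0r normrN => /ltW x1.
rewrite [x in f x]xE linear_sum (le_trans (ler_norm_sum _ _ _))//.
apply: ler_sum => i _; rewrite linearZ normrZ -[leRHS]mul1r ler_wpM2r//.
apply: le_trans x1; rewrite -v2r_norm.
rewrite [leRHS]/Num.norm/= mx_normrE.
by apply/bigmax_geP; right => /=; exists (ord0, i).
Qed.

End FiniteDimension.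

Section Lines.
Variables (R : realType) (U W : normedModType R).

Lemma is_derive_line (f : U -> W) (x v : U) (t : R) :
  differentiable f (x + t *: v) ->
  is_derive t 1 (fun s => f (x + s *: v)) ('d f (x + t *: v) v).
Proof.
move=> df.
have E : (fun h : R => h^-1 *: (f (x + (h *: 1 + t) *: v) - f (x + t *: v))) =
    (fun h : R => h^-1 *: ((f \o shift (x + t *: v)) (h *: v) - f (x + t *: v))).
  apply/funext => h /=; congr (_ *: (f _ - _)).
  by rewrite [h *: 1]mulr1 scalerDl addrCA.
split; first by rewrite /derivable/= E; exact: diff_derivable.
by rewrite -deriveE//; exact: (congr1 (fun F => lim (F @ 0^')) E).
Qed.

(** A difference quotient commutes with [L]. Stated for curves so that it applies
    to derivatives of curves that are not given as differentials. *)
Lemma is_derive_linear_comp (L : {linear U -> W}) (p : R -> U) (t : R) (dp : U) :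
  continuous L -> is_derive t 1 p dp -> is_derive t 1 (L \o p) (L dp).
Proof.
move=> cL [dpt <-].
have cv : (fun h : R => h^-1 *: ((L \o p \o shift t) (h *: 1) - (L \o p) t))
    @ 0^' --> L ('D_1 p t).
  rewrite (_ : (fun h : R => _) =
      L \o (fun h : R => h^-1 *: ((p \o shift t) (h *: 1) - p t))).
    apply: continuous_cvg; last exact: dpt.
    exact: cL.
  by apply/funext => h; rewrite /comp linearZ/=; congr (_ *: _); rewrite raddfB.
by split; [apply/cvg_ex; exists (L ('D_1 p t)) | exact: cvg_lim].
Qed.

End Lines.

Section HigherOrder.
Variables (R : realType).
Implicit Types U W : normedModType R.

Lemma Ck_cst U W k (c : W) : Ck k (cst c : U -> W).
Proof.
elim: k c => [|k IHk] c; first exact: cst_continuous.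
split=> [x|v]; first exact: differentiable_cst.
rewrite (_ : (fun x => _) = cst 0); first exact: IHk.
by apply/funext => x; rewrite diff_cst.
Qed.

(** The differential of [L \o f] is [L] after that of [f], which is again a map of
    the form that the lemma is about. *)
Lemma Ck_linear_comp U W (Z : normedModType R) k (L : {linear W -> Z}) (f : U -> W) :
  continuous L -> Ck k f -> Ck k (L \o f).
Proof.
move=> cL; elim: k f => [f cf x|k IHk f [df ddf]].
  by apply: continuous_comp; [exact: cf | exact: cL].
have dL y : differentiable L y by exact: linear_differentiable.
split=> [x|v]; first exact: differentiable_comp.
rewrite (_ : (fun x => _) = L \o (fun x => 'd f x v)); first exact: IHk _ (ddf v).
by apply/funext => x; rewrite diff_comp//= diff_lin.
Qed.

End HigherOrder.

Section Affine.
Variables (R : realType) (V : vectType R).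
Local Notation N := (normed_of V).

(** The differential is the constant [gamma], so all the later ones vanish. *)
Lemma differential_affine (gamma : V -> V) (a b z v : V) : linear gamma ->
  smooth (tau_inv b \o gamma \o tau a) /\
  differential (tau_inv b \o gamma \o tau a) z v = gamma v.
Proof.
move=> lin.
pose gL : {linear N -> N} :=
  HB.pack (gamma : N -> N) (GRing.isLinear.Build _ _ _ _ (gamma : N -> N) lin).
have cL : continuous gL by exact: normed_of_linear_continuous.
set f := _ \o _ \o _.
have fE : (f : N -> N) = (gL : N -> N) + cst (gL a - (b : N)).
  apply/funext => x; rewrite [RHS]addrA; congr (_ - _).
  exact: (raddfD gL).
have df (x : N) : is_diff x (f : N -> N) gL.
  rewrite fE.
  have dL : is_diff x gL gL.
    by apply: DiffDef; [exact: linear_differentiable | exact: diff_lin].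
  by apply: is_diff_eq; rewrite addr0.
have dfE (x : N) : 'd (f : N -> N) x = gL :> (N -> N).
  by have dx := df x; exact: diff_val.
split; last by rewrite /differential dfE.
case=> [|k].
  by move=> x; apply: differentiable_continuous; exact: ex_diff.
split=> [x|w]; first exact: ex_diff.
rewrite (_ : (fun x => _) = cst (gL w)); first exact: Ck_cst.
by apply/funext => x; rewrite dfE.
Qed.

End Affine.

(** * Symmetry of second derivatives *)

Section Schwarz.
Variables (R : realType) (U : normedModType R).
Implicit Types (f : U -> R) (x u v : U).

Lemma MVT_line f x v (h : R) : (forall y, differentiable f y) -> 0 < h ->
  exists2 t, t \in `]0, h[ & f (x + h *: v) - f x = h * 'd f (x + t *: v) v.
Proof.
move=> df h0.
have dl (t : R) : is_derive t 1 (fun s => f (x + s *: v)) ('d f (x + t *: v) v).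
  exact: is_derive_line.
have [|t t0h] := MVT h0 (fun t _ => dl t).
  apply: continuous_subspaceT => t; apply: differentiable_continuous.
  by apply/derivable1_diffP; exact: ex_derive.
by rewrite scale0r addr0 subr0 mulrC => ->; exists t.
Qed.

(** The mean value theorem twice: in the direction [u] for the increment
    [f (y + h *: v) - f y], then in the direction [v] for ['d f y u]. *)
Lemma second_difference f x u v (h : R) : Ck 2 f -> 0 < h ->
  exists s t, [/\ s \in `]0, h[, t \in `]0, h[ &
    f (x + h *: u + h *: v) - f (x + h *: u) - (f (x + h *: v) - f x) =
    h * (h * 'd (fun y => 'd f y u) (x + s *: u + t *: v) v)].
Proof.
move=> [df ddf] h0; pose g y := f (y + h *: v) - f y.
have dsh y : is_diff y (fun y => y + h *: v) id.
  by apply: is_diff_eq; rewrite addr0.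
have dfh y : differentiable (fun y => f (y + h *: v)) y.
  by apply: (@differentiable_comp _ _ _ _ (fun y => y + h *: v) f).
have dg y : differentiable g y by exact: differentiableB.
have [s s0h Es] := MVT_line x u dg h0.
have [t t0h Et] := MVT_line (x + s *: u) v (ddf u).1 h0.
exists s, t; split=> //; rewrite -Et; apply: etrans Es _; congr (_ * _).
rewrite diffB//=; congr (_ - _).
by rewrite (@diff_comp _ _ _ _ (fun y => y + h *: v) f)//= diff_val.
Qed.

(** The second difference of [f] on the parallelogram spanned by [h *: u] and
    [h *: v] is symmetric in [u] and [v], and is [h ^+ 2] times a value of either
    mixed derivative near [x]. Both are continuous, so they agree at [x]. *)
Lemma schwarz f x u v : Ck 2 f ->
  'd (fun y => 'd f y u) x v = 'd (fun y => 'd f y v) x u.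
Proof.
move=> f2; have cont a b : continuous (fun y => 'd (fun z => 'd f z a) y b).
  by case: f2 => _ ddf; exact: (ddf a).2.
set A := fun y => 'd (fun z => 'd f z u) y v.
set B := fun y => 'd (fun z => 'd f z v) y u.
apply/eqP; rewrite -subr_eq0 -normr_le0; apply/ler_addgt0Pl => e e0; rewrite addr0.
have e2 : 0 < e / 2 by rewrite divr_gt0.
have /cvgrPdist_lt/(_ _ e2)/nbhs_normP[d1 /= d10 A1] := cont u v x.
have /cvgrPdist_lt/(_ _ e2)/nbhs_normP[d2 /= d20 B2] := cont v u x.
(* The radius [h] keeps the parallelogram in the ball of radius [d] around [x];
   the summand 1 in [M] makes it nonzero when [u] and [v] vanish. *)
pose d := Num.min d1 d2; pose M := `|u| + `|v| + 1.
have M0 : 0 < M by rewrite ltr_wpDl// addr_ge0.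
have d0 : 0 < d by rewrite lt_min d10.
pose h := d / M; have h0 : 0 < h by rewrite divr_gt0.
have small s t : s \in `]0, h[ -> t \in `]0, h[ ->
    `|x - (x + s *: u + t *: v)| < d.
  rewrite !in_itv/= => /andP[s0 sh] /andP[t0 th].
  rewrite -addrA opprD addNKr normrN (le_lt_trans (ler_normD _ _))// !normrZ.
  rewrite !gtr0_norm//; have -> : d = h * M by rewrite divfK// gt_eqF.
  rewrite /M mulrDr mulr1 -[ltLHS]addr0 ler_ltD// mulrDr.
  by apply: lerD; rewrite ler_wpM2r// ltW.
have [s [t [s0 t0 Est]]] := second_difference x u v f2 h0.
have [t' [s' [t'0 s'0 Est']]] := second_difference x v u f2 h0.
have : A (x + s *: u + t *: v) = B (x + t' *: v + s' *: u).
  have hn : h != 0 by rewrite gt_eqF.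
  apply: (mulfI hn); apply: (mulfI hn); rewrite -Est -Est'.
  by rewrite (addrAC x); ring.
have /A1 : `|x - (x + s *: u + t *: v)| < d1.
  by have := small _ _ s0 t0; rewrite lt_min => /andP[].
have /B2 : `|x - (x + t' *: v + s' *: u)| < d2.
  by have := small _ _ s'0 t'0; rewrite lt_min (addrAC x) => /andP[].
rewrite -/(A x) -/(B x) -/(A _) -/(B _) => h1 h2 E.
rewrite ltW//; move: h1 h2; rewrite E; set c := B _.
rewrite !ltr_norml => /andP[? ?] /andP[? ?]; apply/andP; split; lra.
Qed.

End Schwarz.

(** * The symplectic form along curves *)

Section Form.
Variables (R : realType) (V : vectType R) (Omega : {biscalar V}).
Local Notation N := (normed_of V).

(** The partial applications of [Omega], on the normed space and with values in [R]
    as a module over itself, so that they are linear maps that the calculus can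
    compose with. *)
Definition form_l (y x : N) : R := Omega x y.
Definition form_r (x y : N) : R := Omega x y.

Let form_l_linear y : linear (form_l y).
Proof. by move=> c u v; rewrite /form_l linearPl. Qed.

Let form_r_linear x : linear (form_r x).
Proof. by move=> c u v; rewrite /form_r linearPr. Qed.

HB.instance Definition _ (y : N) :=
  GRing.isLinear.Build R N R *:%R (form_l y) (form_l_linear y).
HB.instance Definition _ (x : N) :=
  GRing.isLinear.Build R N R *:%R (form_r x) (form_r_linear x).

Definition coordinate i (x : N) : R := v2r (x : V) 0 i.

Let coordinate_linear i : linear (coordinate i).
Proof. by move=> c x y; rewrite /coordinate linearP !mxE. Qed.

HB.instance Definition _ i :=
  GRing.isLinear.Build R N R *:%R (coordinate i) (coordinate_linear i).

(** The Leibniz rule for [Omega]. Expanding the second argument in a basis writes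
    the form as a sum of products of linear functionals. *)
Lemma is_derive_form (p q : R -> N) (t : R) (dp dq : N) :
  is_derive t 1 p dp -> is_derive t 1 q dq ->
  is_derive t 1 (fun s => Omega (p s) (q s)) (Omega dp (q t) + Omega (p t) dq).
Proof.
pose e i : N := r2v (delta_mx 0 i).
have OmegaE (x y : N) :
    Omega x y = \sum_i coordinate i y * form_l (e i) x.
  rewrite -[in LHS](v2rK (y : V)) [v2r (y : V) in LHS]row_sum_delta !linear_sum.
  by apply: eq_bigr => i _; rewrite !linearZ.
move=> dpt dqt.
have d i : is_derive t 1 ((coordinate i \o q) * (form_l (e i) \o p))
    (coordinate i (q t) *: form_l (e i) dp + form_l (e i) (p t) *: coordinate i dq).
  by apply: is_deriveM; apply: is_derive_linear_comp => //;
    exact: normed_of_linear_continuous.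
have -> : (fun s => Omega (p s) (q s)) =
    \sum_i ((coordinate i \o q) * (form_l (e i) \o p)).
  by apply/funext => s; rewrite OmegaE fct_sumE.
apply: is_derive_eq (is_derive_sum d) _.
rewrite !OmegaE -big_split/=; apply: eq_bigr => i _.
by congr (_ + _); exact: mulrC.
Qed.

Lemma theta_E (a z v : V) : theta_ Omega a z v = 2^-1 * Omega (z + a) v.
Proof.
rewrite /theta_ /liouville linearDl mulrDr; congr (_ + _).
rewrite /dform /tangent derive1E.
have d : is_derive (0 : R) 1 (fun t : R => form_r a ((z : N) + t *: (v : N)))
    ('d (form_r a) ((z : N) + (0 : R) *: (v : N)) v).
  apply: is_derive_line; apply: linear_differentiable.
  exact: normed_of_linear_continuous.
have /= := @derive_val _ _ _ _ _ _ _ (@is_deriveZ _ _ _ _ 2^-1 _ _ _ d).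
rewrite diff_lin; last exact: normed_of_linear_continuous.
exact.
Qed.

Hypothesis symp : symplectic Omega.

Lemma form_skew x y : Omega x y = - Omega y x.
Proof.
have [alt _] := symp; have := alt (x + y).
by rewrite linearDl !linearDr/= !alt add0r addr0 => /eqP; rewrite addr_eq0 => /eqP.
Qed.

Lemma form_inj x y : (forall w, Omega x w = Omega y w) -> x = y.
Proof.
move=> xy; apply/eqP; rewrite -subr_eq0; apply/eqP/symp.2 => w.
by rewrite linearBl/= xy subrr.
Qed.

(** Such a map is injective because [Omega] is nonsingular, and an injective
    endomorphism in finite dimension is bijective. *)
Lemma form_preserving_bij (gamma : V -> V) : linear gamma ->
  (forall x y, Omega (gamma x) (gamma y) = Omega x y) -> bijective gamma.
Proof.
move=> lin pres.
pose gL : {linear V -> V} := HB.pack gamma (GRing.isLinear.Build _ _ _ _ _ lin).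
have gE x : linfun gL x = gamma x by rewrite lfunE.
have ker0 : lker (linfun gL) == 0%VS.
  apply/lker0P => x y; rewrite !gE => xy.
  by apply: form_inj => w; rewrite -pres xy pres.
exists (linfun gL)^-1%VF => x; first by rewrite -gE lker0_lfunK.
by rewrite -gE lker0_lfunVK.
Qed.

(** * Maps that pull [theta_ b] back to [theta_ a] *)

Section Rigidity.
Variables (g : V -> V) (a b : V).
Local Notation gN := (g : N -> N).
Hypothesis g2 : Ck 2 gN.
Hypothesis gE : forall z v, Omega (g z + b) (differential g z v) = Omega (z + a) v.

Let dg (z : N) : differentiable gN z.
Proof. exact: g2.1. Qed.

Let ddg (v z : N) : differentiable (fun z : N => 'd gN z v) z.
Proof. exact: (g2.2 v).1. Qed.

Let d2 (z u v : N) : N := 'd (fun z : N => 'd gN z v) z u.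

(** Schwarz for the real-valued function [Omega y \o g]. *)
Let form_d2C (y z u v : N) : Omega y (d2 z u v) = Omega y (d2 z v u).
Proof.
have cf : continuous (form_r y) by exact: normed_of_linear_continuous.
have f2 : Ck 2 (form_r y \o gN) by exact: Ck_linear_comp.
have E w w' : 'd (fun z => 'd (form_r y \o gN) z w) z w' = form_r y (d2 z w' w).
  rewrite (_ : (fun z => _) = form_r y \o (fun z => 'd gN z w)).
    rewrite diff_comp//=; last exact: linear_differentiable.
    by rewrite diff_lin.
  apply/funext => x; rewrite diff_comp//=; last exact: linear_differentiable.
  by rewrite diff_lin.
by have := schwarz z v u f2; rewrite !E.
Qed.

(** The derivative of [gE] in [z] in the direction [u]. *)
Let form_dg_d2 (z u v : N) :
  Omega (differential g z u) (differential g z v) + Omega (g z + b) (d2 z u v) =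
  Omega u v.
Proof.
have dl (f : N -> N) : (forall x, differentiable f x) ->
    is_derive (0 : R) 1 (fun s => f (z + s *: u)) ('d f z u).
  move=> df; have := is_derive_line (df (z + (0 : R) *: u)).
  by rewrite scale0r addr0.
have d1 : is_derive (0 : R) 1 (fun s => gN (z + s *: u) + (b : N)) ('d gN z u).
  have := is_deriveD (dl gN dg) (is_derive_cst (b : N) (0 : R^o) (1 : R^o)).
  by rewrite addr0.
have d2' : is_derive (0 : R) 1 (fun s => 'd gN (z + s *: u) v) (d2 z u v).
  exact: (dl (fun x => 'd gN x v)).
have /= lhs := is_derive_form d1 d2'.
have rhs : is_derive (0 : R) 1
    (fun s => form_l v (((z : N) + a) + s *: (u : N))) (Omega u v).
  have cl : continuous (form_l v) by exact: normed_of_linear_continuous.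
  have /= := @is_derive_line _ _ _ (form_l v) ((z : N) + a) u 0
    (linear_differentiable _ cl).
  by rewrite diff_lin.
have E : (fun s : R => Omega (gN (z + s *: u) + (b : N)) ('d gN (z + s *: u) v)) =
    (fun s => form_l v (((z : N) + a) + s *: (u : N))).
  by apply/funext => s; rewrite [LHS]gE /form_l addrAC.
have := @derive_val _ _ _ _ _ _ _ lhs.
by rewrite E (@derive_val _ _ _ _ _ _ _ rhs) scale0r addr0 => <-.
Qed.

(** Subtracting the instances of [form_dg_d2] for [(u, v)] and [(v, u)] cancels the
    second derivatives and doubles the skew-symmetric terms. *)
Lemma differential_preserves_form (z u v : V) :
  Omega (differential g z u) (differential g z v) = Omega u v.
Proof.
have := form_dg_d2 z u v; have := form_dg_d2 z v u.
rewrite form_d2C (form_skew (differential g z v)) (form_skew v u).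
move=> h1 h2; lra.
Qed.

Lemma differential_linear z : linear (differential g z).
Proof. by move=> c x y; rewrite /differential linearP. Qed.

(** [g] carries the Euler vector field centred at [- a] to the one centred at [- b]:
    both sides have the same pairing with every [differential g z v], and these
    vectors exhaust [V]. *)
Lemma euler (z : V) : g z + b = differential g z (z + a).
Proof.
have [k _ kK] : bijective (differential g z).
  by apply: form_preserving_bij; [exact: differential_linear |
    exact: differential_preserves_form].
by apply: form_inj => w; rewrite -(kK w) gE differential_preserves_form.
Qed.

(** Paired with [y], the curve [g (- a + t *: w) + b] becomes a function [P] with
    derivative [Q], and [euler] gives [P t = t * Q t]. Comparing derivatives,
    [t * Q^`() t = 0], so [Q] is constant on the segment from 0 to 1, the mean
    value theorem needing [Q^`()] only at positive times. *)
Lemma Iso_radial (w : V) : g (w - a) + b = differential g (- a) w.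
Proof.
apply: form_inj => y; set a' : N := - a.
pose Q (t : R) : R := form_l y ('d gN (a' + t *: (w : N)) w).
pose dQ (t : R) : R := form_l y (d2 (a' + t *: (w : N)) w w).
have cl : continuous (form_l y) by exact: normed_of_linear_continuous.
have QdQ (t : R) : is_derive t 1 Q (dQ t).
  apply: (@is_derive_linear_comp _ _ _ (form_l y)) => //.
  exact: (@is_derive_line _ _ _ (fun x => 'd gN x w)).
pose P (t : R) : R := form_l y (gN (a' + t *: (w : N)) + (b : N)).
have PQ (t : R) : P t = t * Q t.
  rewrite /P /Q /form_l.
  have -> : gN (a' + t *: (w : N)) + (b : N) = t *: 'd gN (a' + t *: (w : N)) w.
    by rewrite [LHS]euler /a' addrAC addNr add0r /differential linearZ.
  by rewrite linearZl_LR.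
have PdP (t : R) : is_derive t 1 P (Q t).
  apply: (@is_derive_linear_comp _ _ _ (form_l y)) => //.
  have := is_deriveD (is_derive_line (dg (a' + t *: (w : N))))
    (is_derive_cst (b : N) (t : R^o) (1 : R^o)).
  by rewrite addr0.
have dQ0 (t : R) : 0 < t -> dQ t = 0.
  move=> t0; have := @derive_val _ _ _ _ _ _ _ (PdP t).
  have -> : P = id * Q by apply/funext.
  rewrite (@derive_val _ _ _ _ _ _ _ (is_deriveM (is_derive_id t 1) (QdQ t))).
  rewrite [_ *: 1]mulr1 => /(canRL (addrK _)); rewrite subrr.
  by move/eqP; rewrite mulf_eq0 gt_eqF//= => /eqP.
have [|c c01] := MVT ltr01 (fun t _ => QdQ t).
  apply: continuous_subspaceT => t; apply: differentiable_continuous.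
  by apply/derivable1_diffP; exact: ex_derive.
rewrite dQ0 ?mul0r => [/eqP|]; last by move: c01; rewrite in_itv/= => /andP[].
rewrite subr_eq0 => /eqP Q10.
have := PQ 1; rewrite mul1r Q10 /P /Q scale0r addr0 scale1r /form_l.
by rewrite [a' + _]addrC.
Qed.

End Rigidity.

End Form.

(** * Isomorphisms between the translates *)

Theorem mainTheorem7 (R : realType) (V : vectType R) (Omega : {biscalar V})
    (symp : symplectic Omega) (a b : V) :
  Iso (theta_ Omega a) (theta_ Omega b) =
  [set tau_inv b \o gamma \o tau a | gamma in Sp Omega].
Proof.
have half0 : 2^-1 != 0 :> R by rewrite invr_eq0 pnatr_eq0.
apply/seteqP; split=> [g [gs gE]|_ [gamma [lin _ pres] <-]].
  have gE' z v : Omega (g z + b) (differential g z v) = Omega (z + a) v.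
    have := congr1 (fun alpha => alpha z v) gE.
    by rewrite /pullback !theta_E => /(mulfI half0).
  have g2 := gs 2.
  have lin := @differential_linear _ _ g (- a).
  have pres := differential_preserves_form symp g2 gE' (- a).
  (* The linear part is the differential at the zero of [theta_ a]. *)
  exists (differential g (- a)).
    split; [exact: lin | exact: (form_preserving_bij symp lin pres) | exact: pres].
  apply/funext => z; rewrite /tau_inv /tau/=.
  by rewrite -(Iso_radial symp g2 gE') !addrK.
split; first by have [] := differential_affine a b 0 0 lin.
apply/funext => z; apply/funext => v.
rewrite /pullback !theta_E (differential_affine a b z v lin).2.
by rewrite /tau_inv /tau/= subrK pres.
Qed.
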